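(* Let $\mathfrak{L}\subset\mathbb{R}$ be the Lagrange-like spectrum of perfect additive complements (defined in the context). Then: (1) The set $\mathfrak{L}$ is closed. (2) The set $\mathfrak{L}$ has a smallest accumulation point $\gamma_0$, and the set $[\frac32,\gamma_0)\cap\mathfrak{L}$ is countably infinite and given explicitly as follows: $\gamma_0=\frac{2}{1+\lambda_0}$ and $[\frac32,\gamma_0)\cap\mathfrak{L}=\{\gamma_1,\gamma_2,\ldots\}$, where $\gamma_n=\frac{2}{1+\lambda_n}$ for $n\ge 1$ is a strictly increasing sequence converging to $\gamma_0$ (the numbers $\lambda_n$, $n\ge 0$, are defined in the context). (3) $\left[\frac74,2\right]\subseteq\mathfrak{L}$, but $\left[\frac{12}{7}-\delta,2\right]\not\subseteq\mathfrak{L}$ for every $\delta>0$. (4) The Lebesgue measure of $[\frac32,\frac{17}{10}]\cap\mathfrak{L}$ is zero.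
   Context: $\mathbb{Z}^+$ is the set of positive integers and $\mathbb{Z}_{\ge2}$ is the set of integers at least $2$. For a sequence $(m_i)_{i\ge1}$ with $m_i\in\mathbb{Z}_{\ge2}$ put $$D_k=\frac{1}{m_k}-\frac{1}{m_km_{k-1}}+\frac{1}{m_km_{k-1}m_{k-2}}-\dots+(-1)^{k-1}\frac{1}{m_km_{k-1}\cdots m_1}.$$ The Lagrange-like spectrum is $$\mathfrak{L}=\left\{\limsup_{k\to\infty}\frac{2}{1+D_k} : (m_i)\in\mathbb{Z}_{\ge2}^{\mathbb{Z}^+}\right\}.$$ Explicit sequences. For $m\ge2$ let $T_m(x)=\frac{1-x}{m}$ on $\mathbb{R}$, and for a finite word $\mathbf{i}=(i_1,\ldots,i_n)$ of integers $\ge 2$ let $T_{\mathbf i}=T_{i_1}\circ\cdots\circ T_{i_n}$; this is a contraction, and $\mathrm{Fix}(T_{\mathbf i})$ denotes its unique fixed point. Define finite words recursively by $M^{(1)}=(2)$, $M^{(2)}=(3)$ and the concatenation $M^{(n)}=M^{(n-1)}M^{(n-2)}M^{(n-2)}$ for $n\ge3$ (so $M^{(3)}=(3,2,2)$, $M^{(4)}=(3,2,2,3,3)$, etc.). For $n\geq 3$ the word $M^{(n)}$ starts with $M^{(n-1)}$, so there is a unique infinite sequence $(M_1,M_2,\ldots)$ having $M^{(n)}$ as a prefix for every $n\ge2$. For $n\ge1$ put $\lambda_n=\mathrm{Fix}(T_{M^{(n)}})$, and put $$\lambda_0=\sum_{l=1}^{\infty}\frac{(-1)^{l-1}}{M_1M_2\cdots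 M_l}.$$ *)

(* Defs.v *)
From mathcomp Require Import all_boot all_order all_algebra.
From mathcomp Require Import all_classical all_reals all_analysis.
From mathcomp Require Import ring lra zify.

Set Implicit Arguments.
Unset Strict Implicit.
Unset Printing Implicit Defensive.

Import Order.TTheory GRing.Theory Num.Theory.
Import numFieldNormedType.Exports.

Local Open Scope classical_set_scope.
Local Open Scope ring_scope.

(* Sequences indexed by the positive integers are functions on nat whose value
   at index 0 is irrelevant. *)
Definition ge2_seqs : set (nat -> nat) :=
  [set m | forall i, (1 <= i)%N -> (2 <= m i)%N].

(* The j-th term has denominator m_k m_(k-1) ... m_(k-j+1). *)
Definition altD (R : realType) (m : nat -> nat) (k : nat) : R :=
  \sum_(1 <= j < k.+1)
    (-1) ^+ j.-1 / \prod_((k - j).+1 <= i < k.+1) (m i)%:R.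

(* By altD_itv, the sequence is bounded, so limn_sup is the genuine
   limsup.  The term k = 0 (an empty sum) does not affect it. *)
Definition lagrange_like_spectrum (R : realType) : set R :=
  [set limn_sup (fun k => 2 / (1 + altD R m k)) | m in ge2_seqs].
Arguments lagrange_like_spectrum : clear implicits.

Definition Tmap (R : realType) (m : nat) (x : R) : R := (1 - x) / m%:R.

Definition Tword (R : realType) (w : seq nat) : R -> R :=
  foldr (fun i f => @Tmap R i \o f) idfun w.

(* The value 0 is a default, unused for nonempty words of integers >= 2:
   see FixP. *)
Definition Fix (R : realType) (w : seq nat) : R :=
  xget 0 [set x | Tword w x = x].
Arguments Fix : clear implicits.

(* Mword 0 is a junk value. *)
Fixpoint Mword (n : nat) : seq nat :=
  match n with
  | 0 => [::]
  | 1 => [:: 2%N]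
  | 2 => [:: 3%N]
  | (n2.+1 as n1).+1 => Mword n1 ++ Mword n2 ++ Mword n2
  end.

(* The infinite sequence M_1, M_2, ... is indexed from 1; Mseq 0 is a junk value.
   See MwordE and Mseq_unique for its characterization by prefixes. *)
Definition Mseq (i : nat) : nat := nth 0%N (Mword i.+2) i.-1.

Definition lambda (R : realType) (n : nat) : R :=
  if n is 0 then
    \big[+%R/0]_(1 <= l <oo) ((-1) ^+ l.-1 / \prod_(1 <= i < l.+1) (Mseq i)%:R : R)
  else Fix R (Mword n).
Arguments lambda : clear implicits.

Definition gamma (R : realType) (n : nat) : R := 2 / (1 + lambda R n).
Arguments gamma : clear implicits.

Lemma MwordS n : Mword n.+3 = Mword n.+2 ++ Mword n.+1 ++ Mword n.+1.
Proof. by []. Qed.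

Lemma Mword_ge2 n : all (leq 2) (Mword n).
Proof.
have [->//|n_gt0] := posnP n; rewrite -(prednK n_gt0).
suff /andP[] : all (leq 2) (Mword n.-1.+1) && all (leq 2) (Mword n.-1.+2) by [].
by elim: n.-1 => // k /andP[h1 h2]; rewrite h2 MwordS !all_cat h1 h2.
Qed.

Lemma size_Mword_gt0 n : (0 < size (Mword n.+1))%N.
Proof.
case: n => [//|]; elim=> [//|n IH].
by rewrite MwordS size_cat; lia.
Qed.

Lemma size_Mword_gt n : (n < size (Mword n.+2))%N.
Proof.
elim: n => [//|n IH]; rewrite MwordS !size_cat.
by have := size_Mword_gt0 n; lia.
Qed.

Lemma nth_Mword_le n p i : (2 <= n)%N -> (n <= p)%N ->
  (i < size (Mword n))%N ->
  (i < size (Mword p))%N /\ nth 0%N (Mword p) i = nth 0%N (Mword n) i.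
Proof.
move=> n2 /subnKC <- lti; elim: (p - n)%N => [|q [IH1 IH2]]; first by rewrite addn0.
have [r Hr] : exists r, (n + q)%N = r.+2 by exists (n + q).-2; lia.
rewrite addnS; move: IH1 IH2; rewrite Hr => IH1 <-.
by rewrite MwordS size_cat nth_cat IH1; split; lia.
Qed.

Lemma MwordE n : (2 <= n)%N ->
  Mword n = [seq Mseq i | i <- iota 1 (size (Mword n))].
Proof.
move=> n2; apply: (@eq_from_nth _ 0%N); first by rewrite size_map size_iota.
move=> i lti; rewrite (nth_map 0%N) ?size_iota// nth_iota// add1n /Mseq.
have lti3 : (i < size (Mword i.+3))%N.
  exact: leq_trans (size_Mword_gt i.+1).
have [_ <-] := nth_Mword_le n2 (leq_maxl n i.+3) lti.
by have [_ <-] := nth_Mword_le (isT : 2 <= i.+3)%N (leq_maxr n i.+3) lti3.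
Qed.

Lemma Mseq_unique (s : nat -> nat) :
  (forall n, (2 <= n)%N -> Mword n = [seq s i | i <- iota 1 (size (Mword n))]) ->
  forall i, (1 <= i)%N -> s i = Mseq i.
Proof.
move=> sP [//|i] _.
have lti : (i < size (Mword i.+3))%N by exact: leq_trans (size_Mword_gt i.+1).
by rewrite /Mseq (sP i.+3 isT) (nth_map 0%N) ?size_iota// nth_iota// add1n.
Qed.

Lemma Tword_affine (R : realType) i w : all (leq 2) (i :: w) ->
  exists a b : R, `|b| <= 1 / 2 /\ forall x, Tword (i :: w) x = a + b * x.
Proof.
elim: w i => [|j w IH] i /= /andP[i2 w2]; have i2R : (2 : R) <= i%:R by rewrite ler_nat.
  exists (i%:R^-1), (- i%:R^-1); split; last by move=> x; rewrite /= /Tmap; lra.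
  by rewrite normrN normfV ger0_norm ?ler0n// div1r lef_pV2 ?posrE; lra.
have [a [b [hb ab]]] := IH _ w2.
exists ((1 - a) / i%:R), (- b / i%:R); split.
  rewrite normrM normrN normfV (ger0_norm (ler0n _ _)) ler_pdivrMr; last lra.
  by apply: (le_trans hb); lra.
by move=> x; move: (ab x) => /= ->; rewrite /Tmap; lra.
Qed.

Lemma FixP (R : realType) w : w != [::] -> all (leq 2) w ->
  Tword w (Fix R w) = Fix R w /\ forall x : R, Tword w x = x -> x = Fix R w.
Proof.
case: w => [//|i w] _ /(Tword_affine R)[a [b [hb ab]]].
have b1 : 1 - b != 0.
  by move: hb; rewrite ler_norml => /andP[_ ?]; apply/eqP => ?; lra.
have FT : Tword (i :: w) (Fix R (i :: w)) = Fix R (i :: w).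
  apply: (@xgetPex _ 0 [set x : R | Tword (i :: w) x = x]).
  exists (a / (1 - b)) => /=; move: (ab (a / (1 - b))) => /= ->.
  by field.
split=> // x; move: FT; rewrite !ab => FT xT.
apply: (mulfI b1); lra.
Qed.

Lemma altDS (R : realType) m k :
  altD R m k.+1 = Tmap (m k.+1) (altD R m k).
Proof.
rewrite /altD /Tmap mulrBl div1r big_nat_recl//= expr0 subSS subn0.
rewrite big_nat1 div1r; congr (_ + _).
rewrite mulr_suml -sumrN; apply: eq_big_nat => j /andP[j1 jk].
rewrite subSS [in LHS]big_nat_recr /=; last by lia.
rewrite -{1}(prednK j1) exprS mulN1r !mulNr -mulrA -invfM; congr (- (_ * _)).
Qed.

Lemma altD_itv (R : realType) m k : ge2_seqs m -> 0 <= altD R m k <= 1.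
Proof.
move=> m2; elim: k => [|k /andP[D0 D1]].
  by rewrite /altD big_geq// lexx ler01.
have m2R : (2 : R) <= (m k.+1)%:R by rewrite ler_nat m2.
rewrite altDS /Tmap divr_ge0 ?ler_pdivrMr; lra.
Qed.

(* Main.v *)
Require Import Defs.
From mathcomp Require Import all_boot all_order all_algebra.
From mathcomp Require Import all_classical all_reals all_analysis.
From mathcomp Require Import ring lra zify.

Import Order.TTheory GRing.Theory Num.Theory.
Import numFieldNormedType.Exports.

Local Open Scope classical_set_scope.
Local Open Scope ring_scope.

(** With T_m(x) = (1 - x)/m, the numbers D_k satisfy D_k = T_{m_k}(D_{k-1}), so
    a point of the spectrum is 2/(1 + l) for l a lower limit of an orbit of this
    contracting system of maps ([spectrumE]); everything is proved for l.

    Closedness.  The future of an orbit depends on its past only through the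
    current value, up to an error that contracts.  Hence l is a lower limit as
    soon as, for every e > 0, a finite stretch of orbit leads from within e of l
    back to within e of l while staying above l - e: such stretches can be
    concatenated ([loop_lower_limit]), and the criterion is a closed condition.

    Intervals.  For 0 < l <= 1/7 the images of [l, (1 - l)/2] under the maps T_a
    cover this interval, so that pulling a small interval back by expanding
    branches always meets a point coming from l ([run_dense]); this yields orbits
    from l to any neighbourhood of l, hence every such l, and 0 by closedness.

    Gaps and measure.  The accumulation points of an orbit with lower limit l > 0
    form a set S of points >= l in which every x has a predecessor 1 - a x
    ([lower_limit_backward]).  Just above 1/6 the predecessors are forced and
    can be steered into a hole, which gives missing points arbitrarily near 12/7
    ([gap_near_sixth]).  For l >= 3/17 the inclusions that S satisfies under
    T_2, T_3 and T_4 shrink covers by intervals geometrically ([covers_shrink]),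
    so the corresponding part of the spectrum is null.

    The discrete part.  Write A, B for T_2, T_3 and A', B' for B, B A A; the
    words M^(n) spell the iterates of this substitution, whose fixed point is
    the word of lambda_0.  If l > lambda_0 is a value of A, then all of S is
    made of values of A and l is the fixed point of A.  Otherwise comparison with
    lambda_0 forbids B A B and B A A A, so the part of S made of values of B is
    again such a set for A', B' ([stageS]).  If this never stops, l = lambda_0.
    So the lower limits above lambda_0 are among the lambda_n, and each lambda_n
    is one because its periodic orbit stays above it ([suffix_gt]). *)

Set Implicit Arguments.
Unset Strict Implicit.
Unset Printing Implicit Defensive.

(** * The recursion as a contracting dynamical system *)

Lemma expr_small (R : realType) (q e : R) : 0 <= q < 1 -> 0 < e ->
  exists N, forall n, (N <= n)%N -> q ^+ n <= e.
Proof.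
move=> /andP[q0 q1] e0; have cq : q ^+ n @[n --> \oo] --> (0 : R).
  by apply: cvg_expr; rewrite ger0_norm.
have /cvgrPdist_le/(_ _ e0)[N _ hN] := cq; exists N => n /hN.
by rewrite sub0r normrN; exact: ler_normlW.
Qed.

(** The first digit of the word acts first, so that appending a digit is one
    more step of the recursion. *)
Definition run (R : realType) (x : R) (w : seq nat) : R :=
  foldl (fun y i => Tmap i y) x w.

Lemma Tword_run (R : realType) (w : seq nat) (x : R) :
  Tword w x = run x (rev w).
Proof.
by rewrite /run foldl_rev /Tword; elim: w => //= i w ->.
Qed.

Lemma run_cat (R : realType) (x : R) (v w : seq nat) :
  run x (v ++ w) = run (run x v) w.
Proof. exact: foldl_cat. Qed.

Lemma run_rcons (R : realType) (x : R) (w : seq nat) i :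
  run x (rcons w i) = Tmap i (run x w).
Proof. by rewrite -cats1 run_cat. Qed.

Lemma Tmap_dist (R : realType) i (x y : R) : (2 <= i)%N ->
  `|Tmap i x - Tmap i y| <= `|x - y| / 2.
Proof.
move=> i2; have i2R : (2 : R) <= i%:R by rewrite ler_nat.
have -> : Tmap i x - Tmap i y = (y - x) / i%:R.
  by rewrite /Tmap -mulrBl; congr (_ / _); lra.
rewrite normrM distrC normfV (ger0_norm (ler0n _ _)).
by apply: ler_wpM2l => //; rewrite lef_pV2 ?posrE; lra.
Qed.

Lemma run_dist (R : realType) (w : seq nat) (x y : R) : all (leq 2) w ->
  `|run x w - run y w| <= `|x - y| * (1 / 2) ^+ size w.
Proof.
elim: w x y => [|i w IH] x y /=; first by rewrite expr0 mulr1.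
move=> /andP[i2 /IH h]; rewrite exprS mulrA.
apply: (le_trans (h _ _)); apply: ler_wpM2r; first by apply: exprn_ge0; lra.
by rewrite mul1r; exact: Tmap_dist.
Qed.

Lemma run_dist_le (R : realType) (w : seq nat) (x y : R) : all (leq 2) w ->
  `|run x w - run y w| <= `|x - y|.
Proof.
move=> w2; apply: (le_trans (run_dist _ _ w2)).
by rewrite -[leRHS]mulr1 ler_wpM2l// exprn_ile1//; lra.
Qed.

Lemma run_dist_half (R : realType) (w : seq nat) (x y : R) : w != [::] ->
  all (leq 2) w -> `|run x w - run y w| <= `|x - y| / 2.
Proof.
case: w => [//|i w] _ w2; apply: (le_trans (run_dist _ _ w2)).
have h : (1 / 2 : R) ^+ size w <= 1 by apply: exprn_ile1; lra.
by rewrite ler_wpM2l//= exprS; lra.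
Qed.

Lemma all_take T (p : pred T) (s : seq T) n : all p s -> all p (take n s).
Proof. by rewrite -{1}(cat_take_drop n s) all_cat => /andP[]. Qed.

Lemma altD_run (R : realType) m N j :
  altD R m (N + j) = run (altD R m N) [seq m i | i <- iota N.+1 j].
Proof.
elim: j => [|j IH]; first by rewrite addn0.
by rewrite addnS altDS IH -[j.+1]addn1 iotaD map_cat run_cat /= addSn.
Qed.

Lemma altD0 (R : realType) m : altD R m 0 = 0.
Proof. by rewrite /altD big_geq. Qed.

(** * Lower limits of the recursion *)

Definition liminf_is (R : realType) (u : nat -> R) (l : R) :=
  (forall e : R, 0 < e -> exists N, forall k, (N <= k)%N -> l - e <= u k) /\
  (forall e : R, 0 < e -> forall N, exists2 k, (N <= k)%N & u k <= l + e).

Definition limsup_is (R : realType) (u : nat -> R) (l : R) :=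
  (forall e : R, 0 < e -> exists N, forall k, (N <= k)%N -> u k <= l + e) /\
  (forall e : R, 0 < e -> forall N, exists2 k, (N <= k)%N & l - e <= u k).

Lemma limsup_is_unique (R : realType) (u : nat -> R) l l' :
  limsup_is u l -> limsup_is u l' -> l = l'.
Proof.
suff le a b : limsup_is u a -> limsup_is u b -> a <= b.
  by move=> h h'; apply/le_anti; rewrite !le//.
move=> [_ ha] [hb _]; apply/ler_addgt0Pr => e e0.
have e20 : 0 < e / 2 by lra.
have [N hN] := hb _ e20; have [k Nk uk] := ha _ e20 N.
by have := hN _ Nk; lra.
Qed.

Lemma limn_supP (R : realType) (u : nat -> R) a b :
  (forall k, a <= u k <= b) -> limsup_is u (limn_sup u).
Proof.
move=> ab.
have ub : has_ubound (range u).
  by exists b => _ [k _ <-]; have /andP[] := ab k.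
have lb : has_lbound (range u).
  by exists a => _ [k _ <-]; have /andP[] := ab k.
have cv := cvg_sups_inf ub lb.
have -> : limn_sup u = inf (range (sups u)) by apply: cvg_lim.
set s := inf _ in cv *.
have lbs : has_lbound (range (sups u)).
  exists a => _ [k _ <-]; have /andP[+ _] := ab k; move/le_trans; apply.
  by apply: ub_le_sup; [exact: has_ubound_sdrop | exists k => /=].
split=> e e0.
  have /cvgrPdist_le/(_ _ e0)[N _ hN] := cv; exists N => k Nk.
  have uk : u k <= sups u N.
    by apply: ub_le_sup; [exact: has_ubound_sdrop | exists k].
  have := hN N (leqnn _); rewrite distrC => /ler_normlW; lra.
move=> N; have sN : s <= sups u N by apply: ge_inf => //; exists N.
have hs : has_sup (sdrop u N).
  by split; [exists (u N), N => /= | exact: has_ubound_sdrop].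
have [_ [k Nk <-] h] := sup_adherent e0 hs; exists k => //.
by move: h sN; rewrite /sups /=; lra.
Qed.

Lemma liminf_exists (R : realType) (u : nat -> R) a b :
  (forall k, a <= u k <= b) -> exists l, liminf_is u l.
Proof.
move=> ab; have : forall k, - b <= - u k <= - a.
  by move=> k; have /andP[] := ab k; rewrite !lerN2 => -> ->.
move=> /limn_supP; set s := limn_sup _ => -[h1 h2]; exists (- s).
split=> e e0.
  by have [N hN] := h1 e e0; exists N => k /hN; lra.
by move=> N; have [k Nk hk] := h2 e e0 N; exists k => //; lra.
Qed.

Definition spectral_map (R : realType) (x : R) : R := 2 / (1 + x).

Lemma spectral_map_dist (R : realType) (x y : R) : 0 <= x -> 0 <= y ->
  `|spectral_map x - spectral_map y| <= 2 * `|x - y|.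
Proof.
move=> x0 y0; rewrite /spectral_map.
have -> : 2 / (1 + x) - 2 / (1 + y) = 2 * ((y - x) * ((1 + x) * (1 + y))^-1).
  by field; apply/andP; split; apply/eqP => ?; lra.
rewrite normrM (ger0_norm (ler0n _ 2)) ler_wpM2l// normrM distrC.
rewrite -[leRHS]mulr1 ler_wpM2l// normfV ger0_norm; last by nra.
by rewrite invf_le1; nra.
Qed.

Lemma spectral_map_le (R : realType) (x y : R) : 0 <= x -> 0 <= y ->
  (spectral_map x <= spectral_map y) = (y <= x).
Proof.
by move=> x0 y0; rewrite /spectral_map ler_pM2l ?lef_pV2 ?posrE ?ltr0n//; lra.
Qed.

Lemma spectral_map_lt (R : realType) (x y : R) : 0 <= x -> 0 <= y ->
  (spectral_map x < spectral_map y) = (y < x).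
Proof. by move=> x0 y0; rewrite !ltNge spectral_map_le. Qed.

Lemma spectral_mapK (R : realType) (x : R) : 0 < x -> spectral_map (2 / x - 1) = x.
Proof.
move=> x0; rewrite /spectral_map; have -> : 1 + (2 / x - 1) = 2 / x by lra.
by field; apply/eqP => ?; lra.
Qed.

Definition lower_limits (R : realType) : set R :=
  [set l | exists2 m, ge2_seqs m & liminf_is (altD R m) l].
Arguments lower_limits : clear implicits.

Lemma lower_limits_ge0 (R : realType) l : lower_limits R l -> 0 <= l <= 1.
Proof.
move=> [m m2 [h1 h2]]; apply/andP; split; apply/ler_addgt0Pr => e e0.
  have [k _] := h2 e e0 0%N; have /andP[] := altD_itv R k m2; lra.
have [N /(_ N (leqnn _))] := h1 e e0; have /andP[] := altD_itv R N m2; lra.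
Qed.

(** Since the spectral map is decreasing, an upper limit in the spectrum is a
    lower limit of the recursion in disguise. *)
Lemma spectrumE (R : realType) :
  lagrange_like_spectrum R = [set spectral_map l | l in lower_limits R].
Proof.
suff main m l : ge2_seqs m -> liminf_is (altD R m) l ->
    limn_sup (fun k => 2 / (1 + altD R m k)) = spectral_map l.
  apply/seteqP; split=> [_ [m m2 <-]|_ [l [m m2 hl] <-]].
    have [l hl] := liminf_exists (fun k => altD_itv R k m2).
    by exists l; [exists m | rewrite (main m l)].
  by exists m => //; exact: main.
move=> m2 hl.
have /andP[l0 l1] : 0 <= l <= 1 by apply: lower_limits_ge0; exists m.
have D01 k := altD_itv R k m2.
apply: (@limsup_is_unique _ (fun k => spectral_map (altD R m k))).
  apply: (@limn_supP _ _ 0 2) => k; have /andP[D0 D1] := D01 k.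
  by rewrite /spectral_map divr_ge0 ?ler_pdivrMr; lra.
have step e (x y : R) : 0 <= x -> 0 <= y -> 0 < e -> y - e / 2 <= x ->
    spectral_map x <= spectral_map y + e.
  move=> x0 y0 e0 xy.
  have [yx|xy'] := leP y x.
    by have : spectral_map x <= spectral_map y; [rewrite spectral_map_le | lra].
  have := spectral_map_dist x0 y0; rewrite (ltr0_norm (_ : x - y < 0)); last lra.
  by move=> /ler_normlW; lra.
case: hl => h1 h2; split=> e e0; have e20 : 0 < e / 2 by lra.
  have [N hN] := h1 _ e20; exists N => k /hN h.
  by apply: step => //; have /andP[] := D01 k.
move=> N; have [k Nk hk] := h2 _ e20 N; exists k => //.
by have /andP[D0 D1] := D01 k; have := @step e l (altD R m k); lra.
Qed.

(** * Almost-loops *)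

(** The lower limits are the points of [0, 1] that have almost-loops of every
    precision; in this form they involve no infinite sequence. *)
Definition loop (R : realType) (l e : R) :=
  exists s w, [/\ w != [::], all (leq 2) w, `|s - l| <= e,
    forall j, l - e <= run s (take j w) & run s w <= l + e].

Lemma lower_limit_loop (R : realType) (l e : R) :
  lower_limits R l -> 0 < e -> loop l e.
Proof.
move=> [m m2 [h1 h2]] e0.
have [N hN] := h1 e e0; have [k1 Nk1 hk1] := h2 e e0 N.
have [k2 k12 hk2] := h2 e e0 k1.+1.
exists (altD R m k1), [seq m i | i <- iota k1.+1 (k2 - k1)]; split.
- by rewrite -size_eq0 size_map size_iota; lia.
- by apply/allP => _ /mapP[i + ->]; rewrite mem_iota => h; apply: m2; lia.
- by rewrite ler_norml; have := hN _ Nk1; lra.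
- move=> j; rewrite -map_take take_iota -altD_run; apply: hN; lia.
- by rewrite -altD_run subnKC//; lia.
Qed.

(** An almost-loop absorbs an error in its starting point, and since its word is
    nonempty it leaves a smaller error at its end. *)
Lemma loop_robust (R : realType) (l e : R) : loop l (e / 8) ->
  exists w, [/\ w != [::], all (leq 2) w & forall x, `|x - l| <= e ->
    (forall j, l - 2 * e <= run x (take j w)) /\ `|run x w - l| <= 3 / 4 * e].
Proof.
move=> [s [w [w0 w2 sl tr en]]]; exists w; split=> // x xl.
have xs : `|x - s| <= e + e / 8.
  have -> : x - s = (x - l) - (s - l) by lra.
  by apply: (le_trans (ler_normB _ _)); lra.
split=> [j|].
  have := run_dist_le x s (all_take j w2); have := tr j.
  by move=> h1 h2; have := le_trans h2 xs; rewrite ler_norml; lra.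
have h := run_dist_half x s w0 w2.
have tw := tr (size w); rewrite take_size in tw.
by move: h; rewrite !ler_norml; lra.
Qed.

(** Concatenating almost-loops with geometrically decreasing error works because
    the recursion depends on its past only through the current value. *)
Lemma loop_lower_limit (R : realType) (l : R) : 0 <= l <= 1 ->
  (forall e : R, 0 < e -> loop l e) -> lower_limits R l.
Proof.
move=> /andP[l0 l1] lp.
pose q n : R := (3 / 4) ^+ n.
have q0 n : 0 < q n by apply: exprn_gt0; lra.
have /choice[W hW] : forall n, exists w, [/\ w != [::], all (leq 2) w &
    forall x, `|x - l| <= q n -> (forall j, l - 2 * q n <= run x (take j w)) /\
      `|run x w - l| <= q n.+1].
  move=> n; have /loop_robust : loop l (q n / 8) by apply: lp; have := q0 n; lra.
  by move=> [w [? ? h]]; exists w; split=> // x /h; rewrite /q exprS.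
pose C n := flatten [seq W i | i <- iota 0 n].
have CS n : C n.+1 = C n ++ W n.
  by rewrite /C -[n.+1]addn1 iotaD map_cat flatten_cat /= cats0.
have W0 n : (0 < size (W n))%N by have [+ _ _] := hW n; case: (W n).
have C2 n : all (leq 2) (C n).
  by elim: n => [//|n IH]; rewrite CS all_cat IH; have [_ -> _] := hW n.
have nK n : (n <= size (C n))%N.
  by elim: n => [//|n IH]; rewrite CS size_cat; have := W0 n; lia.
have nthC n p i : (i < size (C n))%N -> (n <= p)%N ->
    nth 2 (C p) i = nth 2 (C n) i /\ (i < size (C p))%N.
  move=> iK /subnKC <-; elim: (p - n)%N => [|j [IH1 IH2]]; first by rewrite addn0.
  by rewrite addnS CS nth_cat size_cat IH2 IH1; split=> //; lia.
pose m i := nth 2 (C i) i.-1.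
have mE i n : (i < size (C n))%N -> m i.+1 = nth 2 (C n) i.
  move=> iK; rewrite /m /=.
  have [<- _] := nthC _ _ _ (nK i.+1) (leq_maxl i.+1 n).
  by have [<- _] := nthC _ _ _ iK (leq_maxr i.+1 n).
have m2 : ge2_seqs m.
  move=> [//|i] _; rewrite (mE i i.+1 (nK _)).
  by apply: (allP (C2 i.+1)); apply: mem_nth; exact: nK.
have DE n k : (k <= size (C n))%N -> altD R m k = run 0 (take k (C n)).
  move=> kK; rewrite -[k in LHS]add0n altD_run altD0; congr run.
  apply: (@eq_from_nth _ 2) => [|i]; rewrite size_map size_iota.
    by rewrite size_takel.
  move=> ik; rewrite (nth_map 0%N) ?size_iota// nth_iota// nth_take// add1n.
  by apply: mE; lia.
have DK n : `|altD R m (size (C n)) - l| <= q n.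
  elim: n => [|n IH].
    by rewrite /C /= altD0 /q expr0 sub0r normrN ger0_norm.
  rewrite (DE n.+1)// take_size CS run_cat.
  by have [_ _ /(_ _ IH)[_]] := hW n; rewrite (DE n)// take_size.
have DT n j k : (size (C n) <= k)%N -> (k <= size (C (n + j)))%N ->
    l - 2 * q n <= altD R m k.
  move=> nk; elim: j => [|j IH].
    rewrite addn0 => kn; have -> : k = size (C n) by lia.
    by have := DK n; have := q0 n; rewrite ler_norml; lra.
  have [/IH//|jk] := leqP k (size (C (n + j))); rewrite addnS => kj.
  rewrite (DE (n + j).+1)// CS take_cat ltnNge ltnW//= run_cat.
  have [_ _ /(_ _ (DK (n + j)%N))[+ _]] := hW (n + j)%N.
  rewrite (DE (n + j)%N)// take_size => /(_ (k - size (C (n + j)))%N).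
  have : q (n + j)%N <= q n.
    by rewrite /q exprD ler_piMr ?exprn_ile1//; have := q0 n; rewrite /q; lra.
  by lra.
have qsmall e : 0 < e -> exists n, q n <= e / 2.
  move=> e0; have [||N /(_ N (leqnn _))] := @expr_small _ (3 / 4 : R) (e / 2); try lra.
  by exists N.
exists m => //; split=> e e0; have [n hn] := qsmall e e0.
  exists (size (C n)) => k nk.
  have : (k <= size (C (n + k)))%N by have := nK (n + k)%N; lia.
  by move=> /(DT _ _ _ nk); lra.
move=> N; exists (size (C (n + N))%N); first by have := nK (n + N)%N; lia.
have : q (n + N)%N <= q n.
  by rewrite /q exprD ler_piMr ?exprn_ile1//; have := q0 n; rewrite /q; lra.
by have := DK (n + N)%N; rewrite ler_norml; lra.
Qed.

(** An almost-loop of a nearby point is an almost-loop of slightly worse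
    precision, so the characterization by almost-loops passes to limits. *)
Lemma lower_limits_closed (R : realType) (l : R) :
  (forall e : R, 0 < e -> exists2 l', lower_limits R l' & `|l' - l| <= e) ->
  lower_limits R l.
Proof.
move=> h; apply: loop_lower_limit.
  apply/andP; split; apply/ler_addgt0Pr => e e0; have [l' /lower_limits_ge0] := h e e0;
    by move=> /andP[? ?]; rewrite ler_norml; lra.
move=> e e0; have e20 : 0 < e / 2 by lra.
have [l' L' ll'] := h _ e20; have [s [w [w0 w2 sl tr en]]] := lower_limit_loop L' e20.
move: sl ll'; rewrite !ler_norml => sl ll'.
exists s, w; split=> // [|j|].
- by rewrite ler_norml; lra.
- by have := tr j; lra.
- by lra.
Qed.

Lemma spectrum_closed (R : realType) : closed (lagrange_like_spectrum R).
Proof.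
move=> g cg; rewrite spectrumE in cg *.
have near e : 0 < e -> exists2 l, lower_limits R l & `|spectral_map l - g| <= e.
  move=> e0; have [_ [[l Ll <-] h]] := cg _ (nbhsx_ballx g e e0).
  by exists l => //; apply: ltW; rewrite distrC.
have g1 : 1 <= g.
  apply/ler_addgt0Pr => e /near[l /lower_limits_ge0/andP[l0 l1]].
  have : 1 <= spectral_map l by rewrite /spectral_map ler_pdivlMr; lra.
  by rewrite ler_norml; lra.
exists (2 / g - 1); last by apply: spectral_mapK; lra.
apply: lower_limits_closed => e e0.
have [|l Ll h] := near (e / 2); first by lra.
exists l => //; have /andP[l0 l1] := lower_limits_ge0 Ll.
(* the inverse of the spectral map is 2-Lipschitz on [1, +oo[ *)
have -> : l - (2 / g - 1) = (1 + l) * (g - spectral_map l) / g.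
  by rewrite /spectral_map; field; apply/andP; split; apply/eqP => ?; lra.
rewrite !normrM distrC (ger0_norm (_ : 0 <= 1 + l)); last by lra.
rewrite normfV (ger0_norm (_ : 0 <= g)); last by lra.
rewrite ler_pdivrMr; last by lra.
by have := normr_ge0 (spectral_map l - g); nra.
Qed.

(** * The interval of the spectrum above 7/4 *)

(** For l <= 1/7 the intervals T_a([l, (1 - l)/2]) cover [l, (1 - l)/2], so any
    subinterval can be pulled back by the expanding branches x |-> 1 - a x; its
    length at least doubles, until it catches a point (1 - l)/a, which is one
    step away from l. *)
Lemma run_dense (R : realType) (l : R) n (p q : R) : 0 < l <= 1 / 7 ->
  l <= p -> p < q -> q <= (1 - l) / 2 -> 1 <= (q - p) * 2 ^+ n ->
  exists w, [/\ w != [::], all (leq 2) w, p <= run l w <= q &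
    forall j, l <= run l (take j w)].
Proof.
move=> /andP[l0 l7]; elim: n p q => [|n IH] p q lp pq ql; first by rewrite expr0; lra.
move=> big.
have ex : exists a, (0 < a)%N && ((1 - l) / a.+1%:R <= p).
  have c0 : 0 <= (1 - l) / p by apply: divr_ge0; lra.
  have := archi_boundP c0; set b := Num.bound _ => cb.
  exists b.+1; rewrite /= ler_pdivrMr// mulrC -ler_pdivrMr; last lra.
  by apply: (le_trans (ltW cb)); rewrite ler_nat; lia.
case: (ex_minnP ex) => a /andP[a0 ap] amin.
have a2 : (2 <= a)%N.
  case: a a0 ap {amin} => [//|[_|//]] h; exfalso; move: h; lra.
have pa : p < (1 - l) / a%:R.
  rewrite ltNge; apply/negP => h.
  by have := amin a.-1; rewrite (prednK a0) h andbT; lia.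
have a2R : (2 : R) <= a%:R by rewrite ler_nat.
have [aq|qa] := leP ((1 - l) / a%:R) q.
  exists [:: a]; rewrite /= a2; split=> //; first by rewrite aq ltW.
  by case=> [//|j]; apply: (le_trans lp); exact: ltW.
move: ap pa qa; rewrite -natr1 ler_pdivrMr ?ltr_pdivlMr; try lra.
move=> ap pa qa.
have [||||w [w0 w2 /andP[pw wq] tr]] := IH (1 - a%:R * q) (1 - a%:R * p); try nra.
  have -> : 1 - a%:R * p - (1 - a%:R * q) = a%:R * (q - p) by ring.
  apply: (le_trans big); rewrite exprS mulrA ler_wpM2r ?exprn_ge0//.
  by rewrite mulrC ler_wpM2r//; lra.
have pT : p <= Tmap a (run l w) <= q.
  by rewrite /Tmap ler_pdivlMr ?ler_pdivrMr; lra.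
exists (rcons w a); rewrite run_rcons all_rcons a2 w2; split=> //.
  by case: (w).
move=> j; rewrite -cats1 take_cat; case: ltnP => // _.
case: (j - size w)%N => [|i]; rewrite ?take0 ?cats0.
  by rewrite -[w]take_size.
by rewrite /= cats1 run_rcons; lra.
Qed.

(** Almost-loops at x come from run_dense on [x, x + d]; the endpoint 0 is
    recovered by closedness. *)
Lemma lower_limits_itv (R : realType) (l : R) : 0 <= l <= 1 / 7 ->
  lower_limits R l.
Proof.
move=> /andP[l0 l7].
suff pos (x : R) : 0 < x <= 1 / 7 -> lower_limits R x.
  apply: lower_limits_closed => e e0.
  have [le|el] := leP l e.
    exists (Num.min e (1 / 7)); last by rewrite ler_norml; case: (leP e (1 / 7)) => ?; lra.
    by apply: pos; case: (leP e (1 / 7)) => ?; lra.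
  by exists l; [apply: pos; lra | rewrite subrr normr0 ltW].
move=> x17; move: (x17) => /andP[x0 x7].
apply: loop_lower_limit; first by apply/andP; split; lra.
move=> e e0; pose d := Num.min e (1 / 7).
have [d0 de d7] : [/\ 0 < d, d <= e & d <= 1 / 7].
  by rewrite /d; case: (leP e (1 / 7)) => ?; split; lra.
have [n hn] : exists n, 1 <= (x + d - x) * 2 ^+ n.
  have [||N /(_ N (leqnn _)) h] := @expr_small _ (1 / 2 : R) d; try lra.
  exists N.
  have p0 : (0 : R) < 2 ^+ N by apply: exprn_gt0.
  rewrite -ler_pdivrMr// div1r; move: h; rewrite div1r exprVn. lra.
have [|||w [w0 w2 /andP[w1 w3] tr]] := @run_dense _ x n x (x + d) x17 _ _ _ hn; try lra.
exists x, w; split=> //; first by rewrite subrr normr0 ltW.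
  by move=> j; have := tr j; lra.
by lra.
Qed.

(** * Backward-invariant sets *)

(** Since x = T_a (1 - a x), such a set contains a possible past of each of
    its points. *)
Definition backward_set (R : realType) (l : R) (S : set R) :=
  forall x, S x -> l <= x /\ exists2 a, (2 <= a)%N & S (1 - a%:R * x).

(** S consists of the accumulation points of the values of the recursion.
    Near x > 0 only finitely many digits occur, so one of them, say a, occurs
    infinitely often on the way to x, and 1 - a x is an accumulation point too. *)
Lemma lower_limit_backward (R : realType) (l : R) : 0 < l ->
  lower_limits R l -> exists2 S, backward_set l S & S l.
Proof.
move=> l0 [m m2 [h1 h2]]; pose D := altD R m.
have D01 k : 0 <= D k <= 1 by apply: altD_itv.
exists [set x | forall e : R, 0 < e -> forall N, exists2 k, (N <= k)%N & `|D k - x| <= e];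
    last first.
  move=> e e0 N; have [N1 hN1] := h1 e e0; have [k] := h2 e e0 (maxn N N1).
  rewrite geq_max => /andP[Nk N1k] hk; exists k => //.
  by rewrite ler_norml; have := hN1 k N1k; rewrite /D; lra.
move=> x Sx; have lx : l <= x.
  apply/ler_addgt0Pr => e e0; have e20 : 0 < e / 2 by lra.
  have [N hN] := h1 _ e20; have [k Nk] := Sx _ e20 N.
  by have := hN _ Nk; rewrite /D ler_norml; lra.
split=> //; apply: contrapT => noa.
(* otherwise the finitely many candidate predecessors are uniformly avoided *)
have avoid A : exists e : R, 0 < e /\ exists N, forall a k, (2 <= a <= A)%N ->
    (N <= k)%N -> e < `|D k - (1 - a%:R * x)|.
  elim: A => [|A [e [e0 [N hN]]]]; first by exists 1; split=> //; exists 0%N => a k; lia.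
  have [A2|A2] := leqP 2 A.+1; last first.
    by exists 1; split=> //; exists 0%N => a k; lia.
  have [e' [e'0 [N' hN']]] : exists e' : R, 0 < e' /\ exists N', forall k, (N' <= k)%N ->
      e' < `|D k - (1 - A.+1%:R * x)|.
    apply: contrapT => no; apply: noa; exists A.+1 => // e' e'0 N'.
    apply: contrapT => no'; apply: no; exists e'; split=> //; exists N' => k Nk.
    by rewrite ltNge; apply/negP => h; apply: no'; exists k.
  exists (Num.min e e'); split; first by case: (leP e e').
  exists (maxn N N') => a k aA; rewrite geq_max => /andP[Nk N'k].
  have [aA'|aA'] := leqP a A.
    have aa : (2 <= a <= A)%N by lia.
    by have := hN a k aa Nk; case: (leP e e') => ?; lra.
  have -> : a = A.+1 by lia.
  by have := hN' k N'k; case: (leP e e') => ?; lra.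
have c0 : 0 <= 2 / x by apply: divr_ge0; lra.
have := archi_boundP c0; set A := Num.bound _ => cA.
have A0 : (0 : R) < A%:R by lra.
have [e [e0 [N hN]]] := avoid A.
have d0 : 0 < Num.min (e / A%:R) (x / 2).
  by case: (leP (e / A%:R) (x / 2)) => _; rewrite divr_gt0//; lra.
have [[//|k] Nk hk] := Sx _ d0 N.+1.
have [hk1 hk2] : `|D k.+1 - x| <= e / A%:R /\ `|D k.+1 - x| <= x / 2.
  by move: hk; case: (leP (e / A%:R) (x / 2)) => ? ?; split; lra.
have Dk := D01 k.
have DS : (m k.+1)%:R * D k.+1 = 1 - D k.
  by rewrite /D altDS /Tmap mulrC divfK// pnatr_eq0 -lt0n ltnW// m2.
have mA : (m k.+1 <= A)%N.
  rewrite -(ler_nat R); apply: ltW; apply: le_lt_trans cA.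
  rewrite ler_pdivlMr; last lra.
  by move: hk2; rewrite ler_norml => hk2; have := ler0n R (m k.+1); nra.
have := hN (m k.+1) k; rewrite mA m2// => /(_ isT Nk).
have -> : D k - (1 - (m k.+1)%:R * x) = - ((m k.+1)%:R * (D k.+1 - x)).
  by rewrite mulrBr DS; lra.
rewrite normrN normrM (ger0_norm (ler0n _ _)) => h.
have mAR : (m k.+1)%:R <= A%:R :> R by rewrite ler_nat.
have := normr_ge0 (D k.+1 - x); move: hk1; rewrite ler_pdivlMr//; nra.
Qed.

Lemma backward_set_le (R : realType) (l : R) S x : backward_set l S -> 0 < l ->
  S x -> x <= (1 - l) / 2.
Proof.
move=> bS l0 Sx; have [lx [a a2 /bS[h _]]] := bS x Sx.
have a2R : (2 : R) <= a%:R by rewrite ler_nat.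
by nra.
Qed.

(** * A sequence of gaps accumulating at 12/7 *)

(** Slightly above 1/6 the digits of a backward orbit are forced: 4, then the
    digit 2 as long as the orbit stays near the fixed point 1/3 of T_2.  The
    parameters are tuned so that the orbit lands on 17/60, which no digit
    keeps between l and (1 - l)/2. *)
Lemma gap_near_third (R : realType) (l : R) S j : backward_set l S -> 1 / 6 < l ->
  ~ S (1 / 3 - 1 / 20 / 4 ^+ j).
Proof.
move=> bS l6; have l0 : 0 < l by lra.
have digit a (y : R) : 17 / 60 <= y -> (2 <= a)%N -> S y -> S (1 - a%:R * y) -> a = 2%N.
  move=> y1 a2 Sy /bS[h _]; apply/eqP; rewrite eqn_leq a2 andbT -ltnS -(ltr_nat R).
  by rewrite ltNge; apply/negP => a3; nra.
elim: j => [|j IH] Sx; have [_ [a a2 Sa]] := bS _ Sx.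
  have E := digit _ _ _ a2 Sx Sa; rewrite E in Sa; last by rewrite expr0; lra.
  by have := backward_set_le bS l0 Sa; rewrite expr0; lra.
have x0 : (0 : R) < (4 ^+ j)^-1 by rewrite invr_gt0 exprn_gt0.
have x1 : (4 ^+ j)^-1 <= (1 : R) by rewrite invf_le1 ?exprn_gt0// exprn_ege1//; lra.
have xS : (4 ^+ j.+1)^-1 = (4 ^+ j)^-1 / 4 :> R by rewrite exprS invfM; lra.
rewrite xS in Sx Sa; move: x0 x1 Sx Sa IH; set t := (4 ^+ j)^-1 => x0 x1 Sx Sa IH.
have E := digit _ _ _ a2 Sx Sa; rewrite E in Sa; last by lra.
have [_ [b b2 Sb]] := bS _ Sa.
have F := digit _ _ _ b2 Sa Sb; rewrite F in Sb; last by lra.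
apply: IH; move: Sb; congr S; lra.
Qed.

Lemma gap_near_sixth (R : realType) j :
  ~ lower_limits R (1 / 6 + 1 / 80 / 4 ^+ j).
Proof.
have x0 : (0 : R) < (4 ^+ j)^-1 by rewrite invr_gt0 exprn_gt0.
have x1 : (4 ^+ j)^-1 <= (1 : R) by rewrite invf_le1 ?exprn_gt0// exprn_ege1//; lra.
set l := _ + _ => /lower_limit_backward[|S bS Sl]; first by rewrite /l; lra.
have l6 : 1 / 6 < l by rewrite /l; lra.
have l0 : 0 < l by lra.
apply: (@gap_near_third _ l S j bS l6).
have [_ [a a2 Sa]] := bS _ Sl.
have [h1 _] := bS _ Sa; have h2 := backward_set_le bS l0 Sa.
have a4 : a = 4%N.
  apply/eqP; rewrite eqn_leq -ltnS -(ltr_nat R) -(ltr_nat R 3).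
  by apply/andP; split; rewrite ltNge; apply/negP => h; move: h1 h2; rewrite /l; nra.
by move: Sa; rewrite a4 /l; congr S; lra.
Qed.

(** * The null part of the spectrum *)

Lemma nat_between2_4 a : (2 <= a)%N -> (a < 5)%N -> a = 2%N \/ a = 3%N \/ a = 4%N.
Proof. by lia. Qed.

Definition covers (R : realType) (s : seq (R * R)) (X : set R) :=
  forall x, X x -> has (fun J => J.1 <= x <= J.2) s.

Definition total_length (R : realType) (s : seq (R * R)) : R :=
  \sum_(J <- s) (J.2 - J.1).

Definition unit_subitvs (R : realType) (s : seq (R * R)) :=
  all (fun J => (0 <= J.1) && (J.1 <= J.2) && (J.2 <= 1)) s.

Definition Tmap_itvs (R : realType) a (s : seq (R * R)) : seq (R * R) :=
  [seq (Tmap a J.2, Tmap a J.1) | J <- s].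

Lemma total_length_cat (R : realType) (s t : seq (R * R)) :
  total_length (s ++ t) = total_length s + total_length t.
Proof. by rewrite /total_length big_cat. Qed.

Lemma total_length_ge0 (R : realType) (s : seq (R * R)) :
  unit_subitvs s -> 0 <= total_length s.
Proof.
by move=> /allP hs; rewrite /total_length big_seq; apply: sumr_ge0 => J /hs; lra.
Qed.

Lemma total_length_Tmap (R : realType) a (s : seq (R * R)) :
  total_length (Tmap_itvs a s) = total_length s / a%:R.
Proof.
rewrite /total_length big_map mulr_suml; apply: eq_bigr => J _.
by rewrite /Tmap -mulrBl; congr (_ / _); lra.
Qed.

Lemma unit_subitvs_Tmap (R : realType) a (s : seq (R * R)) : (2 <= a)%N ->
  unit_subitvs s -> unit_subitvs (Tmap_itvs a s).
Proof.
move=> a2 hs; rewrite /unit_subitvs all_map; apply: sub_all hs => J /=.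
have a2R : (2 : R) <= a%:R by rewrite ler_nat.
move=> /andP[/andP[h0 h1] h2]; rewrite /Tmap; apply/andP; split; last first.
  by rewrite ler_pdivrMr; lra.
by rewrite divr_ge0 ?ler_pM2r ?invr_gt0//=; lra.
Qed.

Lemma has_Tmap_itvs (R : realType) a (s : seq (R * R)) x : (2 <= a)%N ->
  has (fun J => J.1 <= 1 - a%:R * x <= J.2) s ->
  has (fun J => J.1 <= x <= J.2) (Tmap_itvs a s).
Proof.
move=> a2; rewrite has_map; apply: sub_has => J /= /andP[h1 h2].
have a2R : (2 : R) <= a%:R by rewrite ler_nat.
by rewrite /Tmap ler_pdivlMr ?ler_pdivrMr; lra.
Qed.

(** Let U and V be the parts of S to the left and to the right of 5/17.  By the
    choice of the bound 3/17, the branches available give V in T_2(U + V) and,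
    up to the point 5/17, U in T_3(U + V) + T_4(U).  The lengths u, v of covers
    thus turn into 7u/12 + v/3 and u/2 + v/2, and 4u + 3v is multiplied by
    at most 23/24: the weights approximate a left eigenvector. *)
Lemma covers_shrink (R : realType) (S : set R) n : backward_set (3 / 17) S ->
  exists u v : seq (R * R), [/\ unit_subitvs u, unit_subitvs v,
    covers u (S `&` [set x | x <= 5 / 17]), covers v (S `&` [set x | 5 / 17 <= x]) &
    4 * total_length u + 3 * total_length v <= (23 / 24) ^+ n].
Proof.
move=> bS.
have S7 x : S x -> x <= 7 / 17.
  by move=> Sx; have := backward_set_le bS _ Sx; lra.
elim: n => [|n [u [v [u1 v1 cu cv h]]]].
  exists [:: (3 / 17, 5 / 17)], [:: (5 / 17, 7 / 17)].
  rewrite /total_length !big_seq1 expr0 /unit_subitvs /= !andbT.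
  split; try lra; move=> x [Sx]; have [x3 _] := bS _ Sx; have x7 := S7 _ Sx.
    by rewrite /= orbF; lra.
  by rewrite /= orbF; lra.
have cuv y : S y -> has (fun J => J.1 <= y <= J.2) (u ++ v).
  move=> Sy; rewrite has_cat; apply/orP; have [y5|y5] := leP y (5 / 17).
    by left; apply: cu.
  by right; apply: cv; split=> //=; exact: ltW.
(* the degenerate interval is for 5/17, which is also T_2(7/17) *)
exists ((5 / 17, 5 / 17) :: Tmap_itvs 3 (u ++ v) ++ Tmap_itvs 4 u),
  (Tmap_itvs 2 (u ++ v)).
have uv1 : unit_subitvs (u ++ v) by rewrite /unit_subitvs all_cat; apply/andP.
have o2 : unit_subitvs (Tmap_itvs 2 (u ++ v)) by exact: unit_subitvs_Tmap.
have o3 : unit_subitvs (Tmap_itvs 3 (u ++ v)) by exact: unit_subitvs_Tmap.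
have o4 : unit_subitvs (Tmap_itvs 4 u) by exact: unit_subitvs_Tmap.
split=> //.
- by rewrite /unit_subitvs /= all_cat; apply/and3P; split=> //; lra.
- move=> x [Sx /= x5]; have [x3 [a a2 Sa]] := bS _ Sx.
  have [y3 _] := bS _ Sa; have y7 := S7 _ Sa.
  have a5 : (a < 5)%N by rewrite -(ltr_nat R) ltNge; apply/negP => a5; nra.
  have [E|[E|E]] := nat_between2_4 a2 a5.
  + by apply/orP; left; move: y7; rewrite E => y7; lra.
  + by apply/orP; right; rewrite has_cat has_Tmap_itvs// cuv// -E.
  + apply/orP; right; rewrite has_cat [X in _ || X]has_Tmap_itvs ?orbT//.
    by apply: cu; split; rewrite -?E//= E; lra.
- move=> x [Sx /= x5]; have [x3 [a a2 Sa]] := bS _ Sx; have [y3 _] := bS _ Sa.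
  have E : a = 2%N.
    apply/eqP; rewrite eqn_leq a2 andbT -ltnS -(ltr_nat R) ltNge.
    by apply/negP => a3; nra.
  by apply: has_Tmap_itvs => //; apply: cuv; rewrite -E.
- rewrite -cat1s !total_length_cat !total_length_Tmap !total_length_cat exprS.
  have -> : total_length [:: ((5 / 17 : R), (5 / 17 : R))] = 0.
    by rewrite /total_length big_seq1 /= subrr.
  by have := total_length_ge0 u1; have := total_length_ge0 v1; lra.
Qed.

Lemma measure_itvs_le (R : realType) (s : seq (R * R)) :
  all (fun J => J.1 <= J.2) s ->
  (lebesgue_measure (\big[setU/set0]_(J <- s) `[J.1, J.2]%classic) <= (total_length s)%:E)%E.
Proof.
have mI (J : R * R) : measurable (`[J.1, J.2] : set R) by exact: measurable_itv.
elim: s => [_|J s IH] /=; first by rewrite big_nil measure0 /total_length big_nil.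
move=> /andP[I12 /IH hs]; rewrite big_cons -cat1s total_length_cat.
have mJ : (lebesgue_measure (`[J.1, J.2]%classic : set R) <= (J.2 - J.1)%:E)%E.
  rewrite lebesgue_measure_itv /=.
  by case: ifPn => _; rewrite -?EFinB lee_fin// subr_ge0.
apply: le_trans (measureU2 _ _ _) _ => //; first exact: bigsetU_measurable.
by rewrite EFinD leeD// /total_length big_seq1.
Qed.

Lemma null_spectrum (R : realType) :
  lebesgue_measure (`[3 / 2, 17 / 10] `&` lagrange_like_spectrum R) = 0%E.
Proof.
set A := (X in lebesgue_measure X).
have mA : measurable A.
  apply: measurableI; first exact: measurable_itv.
  by apply: measurable_realfun.closed_measurable; exact: spectrum_closed.
pose B := [set x : R | exists2 S, backward_set (3 / 17) S & S x].
have bB : backward_set (3 / 17) B.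
  move=> x [S bS Sx]; have [x3 [a a2 Sa]] := bS _ Sx; split=> //.
  by exists a => //; exists S.
apply/eqP; rewrite eq_le measure_ge0 andbT; apply/lee_addgt0Pr => e e0.
rewrite add0e.
have [||n /(_ n (leqnn _)) hn] := @expr_small _ (23 / 24 : R) e; [lra | exact: e0 |].
have [u [v [u1 v1 cu cv h]]] := covers_shrink n bB.
pose s := [seq (spectral_map J.2, spectral_map J.1) | J <- u ++ v].
have uv1 : unit_subitvs (u ++ v) by rewrite /unit_subitvs all_cat; apply/andP.
have s_le : all (fun J => J.1 <= J.2) s.
  by rewrite all_map; apply: sub_all uv1 => J /= hI; rewrite spectral_map_le; lra.
have As : A `<=` \big[setU/set0]_(J <- s) `[J.1, J.2]%classic.
  move=> g [/= + ]; rewrite spectrumE in_itv /= => /andP[_ g17] [l Ll gl].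
  have /andP[l0 l1] := lower_limits_ge0 Ll.
  have l3 : 3 / 17 <= l.
    by move: g17; rewrite -gl /spectral_map ler_pdivrMr; lra.
  have Bl : B l.
    have [|S bS Sl] := lower_limit_backward _ Ll; first by lra.
    exists S => // x Sx; have [lx hx] := bS _ Sx; split=> //; lra.
  have : has (fun J => J.1 <= l <= J.2) (u ++ v).
    rewrite has_cat; apply/orP; have [l5|l5] := leP l (5 / 17).
      by left; apply: cu.
    by right; apply: cv; split=> //=; exact: ltW.
  move=> /hasP[J Iuv lI].
  rewrite -bigcup_seq; exists (spectral_map J.2, spectral_map J.1).
    by apply/mapP; exists J.
  have := allP uv1 _ Iuv => hI.
  by rewrite /= in_itv /= -gl !spectral_map_le; lra.
have ms : measurable (\big[setU/set0]_(J <- s) `[J.1, J.2]%classic).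
  by apply: bigsetU_measurable => J _; exact: measurable_itv.
have le_As : (lebesgue_measure A <=
    lebesgue_measure (\big[setU/set0]_(J <- s) `[J.1, J.2]%classic))%E.
  by apply: le_measure => //; rewrite inE.
apply: (le_trans le_As); apply: (le_trans (measure_itvs_le s_le)); rewrite lee_fin.
have : total_length s <= 2 * total_length (u ++ v).
  rewrite /total_length big_map mulr_sumr big_seq [leRHS]big_seq.
  apply: ler_sum => J /(allP uv1) hI /=.
  have i1 : 0 <= J.1 by lra.
  have i2 : 0 <= J.2 by lra.
  have := spectral_map_dist i1 i2.
  by rewrite [`|J.1 - J.2|]distrC (ger0_norm (_ : 0 <= J.2 - J.1)) => [/ler_normlW|]; lra.
rewrite total_length_cat.
by have := total_length_ge0 u1; have := total_length_ge0 v1; lra.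
Qed.

(** * Renormalization along the words M^(n) *)

Section Renormalization.
Variable R : realType.
Implicit Types x y z l : R.

(** Stage n of the renormalization has the two branches A = renorm n and
    B = renorm n.+1, at first T_2 and T_3; the next stage has B and B A A. *)
Definition renorm n x : R := Tword (Mword n.+1) x.

Lemma Tword_cat v w x : Tword (v ++ w) x = Tword v (Tword w x).
Proof. by rewrite !Tword_run rev_cat run_cat. Qed.

Lemma renormSS n x : renorm n.+2 x = renorm n.+1 (renorm n (renorm n x)).
Proof. by rewrite /renorm MwordS !Tword_cat. Qed.

Lemma Mword_neq0 n : Mword n.+1 != [::].
Proof. by rewrite -size_eq0 -lt0n size_Mword_gt0. Qed.

Lemma renorm_dist n x y : `|renorm n x - renorm n y| <= `|x - y| / 2.
Proof.
rewrite /renorm !Tword_run; apply: run_dist_half; last by rewrite all_rev Mword_ge2.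
by rewrite -size_eq0 size_rev size_eq0 Mword_neq0.
Qed.

Lemma renorm_lt n x y : (renorm n x < renorm n y) = (y < x).
Proof.
suff [] : (forall x y, (renorm n x < renorm n y) = (y < x)) /\
  (forall x y, (renorm n.+1 x < renorm n.+1 y) = (y < x)) by [].
elim: n {x y} => [|n [IH1 IH2]]; last first.
  by split=> // x y; rewrite !renormSS IH2 !IH1.
by split=> x y; rewrite /renorm /= /Tmap ltr_pM2r ?invr_gt0 ?ltr0n// ltrD2l ltrN2.
Qed.

Lemma renorm_le n x y : (renorm n x <= renorm n y) = (y <= x).
Proof. by rewrite !leNgt renorm_lt. Qed.

Lemma renorm_surj n y : exists x, renorm n x = y.
Proof.
have := Mword_ge2 n.+1; have := renorm_lt n 1 0; rewrite /renorm ltr01.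
case E : (Mword n.+1) => [|i w]; first by have := Mword_neq0 n; rewrite E.
move=> lt01 /(Tword_affine R)[a [b [_ ab]]]; exists ((y - a) / b).
rewrite ab mulrC divfK; first by ring.
by apply/eqP => b0; move: lt01; rewrite !ab b0; lra.
Qed.

(** The interval on which both branches of stage n act: at first all values
    with digits 2 and 3, then the image under B, with which both branches of the
    next stage begin. *)
Fixpoint core_ends n : R * R :=
  if n is k.+1 then (renorm k.+1 (core_ends k).2, renorm k.+1 (core_ends k).1)
  else (1 / 5, 2 / 5).

Definition core n x := (core_ends n).1 <= x <= (core_ends n).2.

Lemma coreS n x : core n.+1 x <-> exists2 z, core n z & x = renorm n.+1 z.
Proof.
rewrite /core /=; split=> [|[z h ->]]; last by rewrite !renorm_le andbC.
by have [z <-] := renorm_surj n.+1 x; rewrite !renorm_le andbC; exists z.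
Qed.

Lemma core_ends_le n : (core_ends n).1 <= (core_ends n).2.
Proof. by elim: n => [|n IH] /=; [lra | rewrite renorm_le]. Qed.

Lemma core_width n x y : core n x -> core n y -> `|x - y| <= (1 / 2) ^+ n.
Proof.
move=> cx cy; have : (core_ends n).2 - (core_ends n).1 <= (1 / 2) ^+ n.
  elim: n {cx cy} => [|n IH] /=; first by rewrite expr0; lra.
  have := renorm_dist n.+1 (core_ends n).1 (core_ends n).2.
  have := core_ends_le n; rewrite -subr_le0 => /ler0_norm ->.
  by move=> /(le_trans (ler_norm _)); rewrite exprS; lra.
by move: cx cy; rewrite /core ler_norml; lra.
Qed.

Lemma core_stable n x : core n x -> core n (renorm n x) /\ core n (renorm n.+1 x).
Proof.
elim: n x => [|n IH] x.
  by rewrite /core /renorm /= /Tmap !ler_pdivlMr ?ler_pdivrMr; lra.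
move=> /coreS[z cz ->]; have [_ cBz] := IH _ cz; have [cABz cBBz] := IH _ cBz.
split; apply/coreS; first by exists (renorm n.+1 z).
by rewrite renormSS; eexists; last by []; have [] := IH _ cABz.
Qed.

Lemma core_sub n p x : (n <= p)%N -> core p x -> core n x.
Proof.
move=> /subnKC <-; elim: (p - n)%N x => [|j IH] x; first by rewrite addn0.
by rewrite addnS => /coreS[z cz ->]; apply: IH; have [] := core_stable cz.
Qed.

Lemma core01 n x : core n x -> 1 / 5 <= x <= 2 / 5.
Proof. by move=> /(core_sub (leq0n n)). Qed.

(** On the core the images of the two branches are disjoint: passing from A, B
    to B, B A A amounts to comparing B with A A, that is, B with A again. *)
Lemma renorm_order n x y : core n x -> core n y -> renorm n.+1 x < renorm n y.
Proof.
elim: n x y => [|n IH] x y; first by rewrite /core /renorm /= /Tmap; lra.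
move=> cx /coreS[z cz ->]; rewrite renormSS renorm_lt.
by apply: IH => //; have [] := core_stable (core_sub (leqnSn n) cx).
Qed.

Lemma eq_small x y : (forall k, `|x - y| <= (1 / 2) ^+ k) -> x = y.
Proof.
move=> h; apply/subr0_eq/normr0_eq0/le_anti; rewrite normr_ge0 andbT.
apply/ler_addgt0Pr => e e0; rewrite add0r.
have [||N /(_ N (leqnn _))] := @expr_small _ (1 / 2 : R) e; try lra.
exact: le_trans.
Qed.

(** * The numbers lambda_n *)

Lemma renorm_lambda n : renorm n (lambda R n.+1) = lambda R n.+1.
Proof. by have [] := FixP R (Mword_neq0 n) (Mword_ge2 n.+1). Qed.

(** A fixed point outside the core would be thrown to the other side of the
    core's end by the decreasing map, which sends that end into the core. *)
Lemma lambda_core n : core n (lambda R n.+1).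
Proof.
have le12 := core_ends_le n; have E := renorm_lambda n.
set f := lambda R n.+1 in E *.
have [] : core n (core_ends n).1 /\ core n (core_ends n).2 by rewrite /core !lexx le12.
move=> /core_stable[/andP[lo _] _] /core_stable[/andP[_ hi] _].
apply/andP; split; rewrite leNgt; apply/negP => h.
  have : renorm n (core_ends n).1 < renorm n f by rewrite renorm_lt.
  by rewrite E; lra.
have : renorm n f < renorm n (core_ends n).2 by rewrite renorm_lt.
by rewrite E; lra.
Qed.

Lemma lambda_decr n : lambda R n.+2 < lambda R n.+1.
Proof.
rewrite -[ltLHS]renorm_lambda -[ltRHS]renorm_lambda.
by apply: renorm_order; rewrite ?lambda_core//; apply: core_sub (lambda_core _).
Qed.

Lemma Tword_itv w x : all (leq 2) w -> 0 <= x <= 1 -> 0 <= Tword w x <= 1.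
Proof.
move=> + x01; elim: w => //= i w IH /andP[i2 /IH].
have i2R : (2 : R) <= i%:R by rewrite ler_nat.
by move=> /= h; rewrite /Tmap divr_ge0 ?ler_pdivrMr; lra.
Qed.

Lemma alternating_sum_Tword (s : nat -> nat) n :
  \sum_(1 <= l < n.+1) ((-1) ^+ l.-1 / \prod_(1 <= i < l.+1) (s i)%:R : R) =
  Tword [seq s i | i <- iota 1 n] 0.
Proof.
elim: n s => [|n IH] s; first by rewrite big_geq.
rewrite big_nat_recl//= -(addn1 1) iotaDl -map_comp /Tmap mulrBl div1r.
rewrite -(IH (s \o addn 1%N)) big_nat1 div1r; congr (_ + _).
rewrite mulr_suml -sumrN; apply: eq_big_nat => l /andP[l1 ln].
rewrite -{1}(prednK l1) exprS mulN1r big_nat_recl// invfM mulNr; congr (- _).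
by rewrite -mulrA [X in _ * X]mulrC.
Qed.

(** The partial sums are values of prefixes of the infinite word, so the long
    ones are close to lambda_n for every large n; and the lambda_n lie in the
    nested cores, which shrink to one point. *)
Lemma lambda0_core n : core n (lambda R 0).
Proof.
pose lows := range (fun n => (core_ends n).1).
have lo_hi p q : (core_ends p).1 <= (core_ends q).2.
  have c k : core k (core_ends k).1 /\ core k (core_ends k).2.
    by rewrite /core !lexx core_ends_le.
  have [pq|/ltnW qp] := leqP p q.
    by have := core_sub pq (c q).2; rewrite /core => /andP[].
  by have := core_sub qp (c p).1; rewrite /core => /andP[].
have [c hc] : exists c, forall n, core n c.
  exists (sup lows) => k; apply/andP; split.
    apply: ub_le_sup; last by exists k.
    by exists (core_ends 0).2 => _ [p _ <-].
  by apply: ge_sup; [exists (core_ends 0).1, 0%N | move=> _ [p _ <-]].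
suff -> : lambda R 0 = c by [].
apply: cvg_lim => //; apply/cvgrPdist_le => e e0.
have [||N /(_ N (leqnn _)) hN] := @expr_small _ (1 / 2 : R) (e / 2); try lra.
exists (size (Mword N.+2)).+1 => // -[//|k] Nk /=.
rewrite alternating_sum_Tword.
have -> : k = (size (Mword N.+2) + (k - size (Mword N.+2)))%N by move: Nk => /=; lia.
rewrite iotaD map_cat -MwordE// Tword_cat; set r := [seq _ | _ <- iota _ _].
have r2 : all (leq 2) r.
  apply/allP => _ /mapP[i + ->]; rewrite mem_iota => /andP[i1 _].
  have h : (i.-1 < size (Mword i.+2))%N by have := size_Mword_gt i; lia.
  by apply: (allP (Mword_ge2 i.+2)); rewrite /Mseq mem_nth.
have x01 : 0 <= Tword r (0 : R) <= 1 by apply: Tword_itv => //; rewrite lexx ler01.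
have f01 : 0 <= lambda R N.+2 <= 1 by have := core01 (lambda_core N.+1); lra.
have h1 : `|c - lambda R N.+2| <= (1 / 2) ^+ N.
  by apply: core_width => //; apply: core_sub (lambda_core N.+1).
have h2 : `|lambda R N.+2 - Tword (Mword N.+2) (Tword r 0)| <= (1 / 2) ^+ N.
  rewrite -{1}renorm_lambda /renorm !Tword_run.
  apply: (le_trans (run_dist _ _ _)); first by rewrite all_rev Mword_ge2.
  rewrite size_rev -[leRHS]mul1r ler_pM ?exprn_ge0//; try lra.
    by rewrite -Tword_run ler_norml; lra.
  by apply: ler_wiXn2l; [lra | lra | apply: ltnW; exact: size_Mword_gt].
have -> : c - Tword (Mword N.+2) (Tword r 0) =
  (c - lambda R N.+2) + (lambda R N.+2 - Tword (Mword N.+2) (Tword r 0)) by lra.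
by apply: (le_trans (ler_normD _ _)); lra.
Qed.

Lemma lambda_gt n : lambda R 0 < lambda R n.+1.
Proof.
rewrite -[ltRHS]renorm_lambda.
have /coreS[z cz ->] := lambda0_core n.+1.
by apply: renorm_order => //; exact: lambda_core.
Qed.

(** This keeps the periodic orbit of a word M^(n) above its value at the end of
    the period.  For the word of A the suffix may be the whole word, because cuts
    of B A A can fall at the start of either A. *)
Lemma suffix_gt n x z : core n x -> core n z ->
  (forall i, (i < size (Mword n.+1))%N -> renorm n.+1 z < Tword (drop i (Mword n.+1)) x) /\
  (forall i, (0 < i < size (Mword n.+2))%N ->
    renorm n.+1 z < Tword (drop i (Mword n.+2)) x).
Proof.
elim: n x z => [|n IH] x z cx cz.
  split=> i hi; last by move: hi => /=; lia.
  have -> : i = 0%N by move: hi => /=; lia.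
  by rewrite drop0; exact: (@renorm_order 0).
have cx' := core_sub (leqnSn n) cx; have cz' := core_sub (leqnSn n) cz.
have cAx : core n (renorm n x) by have [] := core_stable cx'.
have cAAx : core n (renorm n (renorm n x)) by have [] := core_stable cAx.
have cAAz : core n (renorm n (renorm n z)).
  by have [+ _] := core_stable cz' => /core_stable[].
split=> [[|i] hi|i /andP[i0 hi]].
- by rewrite drop0; exact: (@renorm_order n.+1).
- by rewrite renormSS; have [_] := IH _ _ cx' cAAz; apply.
rewrite renormSS MwordS drop_cat; case: ltnP => iB.
  rewrite !Tword_cat; have [_ h] := IH _ _ cAAx cAAz; apply: h.
  by rewrite i0.
rewrite MwordS !size_cat in hi; rewrite drop_cat; case: ltnP => iA.
  by rewrite Tword_cat; have [h _] := IH _ _ cAx cAAz; apply: h.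
by have [h _] := IH _ _ cx' cAAz; apply: h; lia.
Qed.

Lemma lambda_lower_limit n : lower_limits R (lambda R n.+1).
Proof.
set f := lambda R n.+1.
have f5 : 1 / 5 <= f <= 2 / 5 by exact: core01 (lambda_core n).
have suf i : f <= Tword (drop i (Mword n.+1)) f.
  have [hi|hi] := leqP (size (Mword n.+1)) i; first by rewrite drop_oversize.
  case: i hi => [|i] hi; first by rewrite drop0 -/(renorm n f) renorm_lambda.
  rewrite /f; case: n @f f5 hi => [//|k] f f5 hi.
  have cf : core k f by apply: core_sub (lambda_core k.+1).
  have [_ h] := suffix_gt cf cf; rewrite -[leLHS]renorm_lambda.
  by apply: ltW; apply: h.
apply: loop_lower_limit; first by lra.
move=> e e0; exists f, (rev (Mword n.+1)); split.
- by rewrite -size_eq0 size_rev size_eq0 Mword_neq0.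
- by rewrite all_rev Mword_ge2.
- by rewrite subrr normr0 ltW.
- move=> j; have := suf (size (Mword n.+1) - j)%N.
  by rewrite Tword_run take_rev; lra.
- by rewrite -Tword_run -/(renorm n f) renorm_lambda -/f; lra.
Qed.

(** * Classification of the lower limits above lambda_0 *)

(** A backward-invariant set for the two branches of stage n. *)
Definition stage n l (S : set R) :=
  forall x, S x -> [/\ core n x, l <= x &
    exists2 z, S z & x = renorm n z \/ x = renorm n.+1 z].

(** Above lambda_0 > 1/5 no digit but 2 and 3 is possible. *)
Lemma stage0 l : lambda R 0 < l -> lower_limits R l -> exists2 S, stage 0 l S & S l.
Proof.
move=> l0 /lower_limit_backward[|S bS Sl].
  by have := core01 (lambda0_core 0); lra.
exists S => // x Sx; have := core01 (lambda0_core 0) => /andP[l5 _].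
have l50 : 0 < l by lra.
have [lx [a a2 Sa]] := bS _ Sx; have x2 := backward_set_le bS l50 Sx.
split=> //; first by rewrite /core /=; lra.
exists (1 - a%:R * x) => //.
have xE : x = Tmap a (1 - a%:R * x).
  by rewrite /Tmap opprB addrC subrK mulrAC divff ?mul1r// pnatr_eq0 -lt0n ltnW.
have a3 : (a < 4)%N.
  rewrite -(ltr_nat R) ltNge; apply/negP => a4.
  by have [h _] := bS _ Sa; nra.
have [E|[E|E]] := nat_between2_4 a2 (ltnW a3 : (a < 5)%N); last by rewrite E in a3.
  by left; rewrite {1}xE E.
by right; rewrite {1}xE E.
Qed.

(** If l is a value of branch n then, that branch being the upper one, every
    element of S is, and contraction leaves only its fixed point.  Otherwise l
    is a value of branch n.+1, and comparison with
    lambda_0 = B A A B B ... (A, B the branches n, n.+1) forbids B A B and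
    B A A A: from a value of B on, the orbit splits into blocks B and B A A,
    the branches of the next stage. *)
Lemma stageS n l S : lambda R 0 < l -> stage n l S -> S l ->
  l = lambda R n.+1 \/ exists2 S', stage n.+1 l S' & S' l.
Proof.
move=> l0 sS Sl; have [cl _ _] := sS _ Sl.
have [[z Sz lE]|noA] := pselect (exists2 z, S z & l = renorm n z).
  left.
  have allA y : S y -> exists2 y', S y' & y = renorm n y'.
    move=> Sy; have [_ ly [y' Sy' [->|E]]] := sS _ Sy; first by exists y'.
    have [cz _ _] := sS _ Sz; have [cy' _ _] := sS _ Sy'.
    by have := renorm_order cy' cz; rewrite -lE -E; lra.
  have near k y : S y -> `|y - lambda R n.+1| <= (1 / 2) ^+ k.
    elim: k y => [|k IH] y Sy.
      have [cy _ _] := sS _ Sy; have := core01 cy; have := core01 (lambda_core n).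
      by rewrite expr0 ler_norml; lra.
    have [y' Sy' ->] := allA _ Sy; rewrite -renorm_lambda.
    apply: (le_trans (renorm_dist _ _ _)).
    by have := IH _ Sy'; rewrite exprS; lra.
  by apply: eq_small => k; exact: near.
right; pose isB y := exists2 z, S z & y = renorm n.+1 z.
have [w cw lam0E] : exists2 w, core n w & lambda R 0 =
    renorm n.+1 (renorm n (renorm n (renorm n.+1 w))).
  have /coreS[w cw wE] := lambda0_core n.+3.
  exists (renorm n.+1 w); last by rewrite wE renormSS renormSS.
  by have [] := core_stable (core_sub (_ : n <= n.+2)%N cw); lia.
exists [set y | S y /\ isB y]; last first.
  by split=> //; have [_ _ [z Sz [E|E]]] := sS _ Sl; [case: noA|]; exists z.
move=> y [Sy [z Sz yE]]; have [cz _ _] := sS _ Sz; have [_ ly _] := sS _ Sy.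
have [cBw cw'] : core n (renorm n.+1 w) /\ core n w by have [] := core_stable cw.
split=> //; first by apply/coreS; exists z.
have [_ _ [z1 Sz1 [zE|zE]]] := sS _ Sz; last first.
  by exists z; [split=> //; exists z1 | left].
have [cz1 _ [z2 Sz2 [z1E|z1E]]] := sS _ Sz1; last first.
  have [cz2 _ _] := sS _ Sz2.
  have : y < lambda R 0; last by lra.
  by rewrite yE zE z1E lam0E !renorm_lt; exact: renorm_order.
have [cz2 _ [z3 Sz3 [z2E|z2E]]] := sS _ Sz2; last first.
  exists z2; first by split=> //; exists z3.
  by right; rewrite yE zE z1E -renormSS.
have [cz3 _ _] := sS _ Sz3.
have : y < lambda R 0; last by lra.
by rewrite yE zE z1E z2E lam0E !renorm_lt; exact: renorm_order.
Qed.

(** A value that survives every stage lies in every core, as lambda_0 does. *)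
Lemma lower_limit_lambda l : lambda R 0 < l -> lower_limits R l ->
  exists n, l = lambda R n.+1.
Proof.
move=> l0 Ll; apply: contrapT => nol.
have st n : exists2 S, stage n l S & S l.
  elim: n => [|n [S sS Sl]]; first exact: stage0.
  by have [E|//] := stageS l0 sS Sl; case: nol; exists n.
suff E : l = lambda R 0 by move: l0; rewrite E ltxx.
apply: eq_small => n; have [S sS Sl] := st n; have [cl _ _] := sS _ Sl.
by apply: core_width => //; exact: lambda0_core.
Qed.

End Renormalization.

(** * The spectrum below gamma_0 *)

Section BelowGamma0.
Variable R : realType.
Implicit Types x : R.

Lemma lambda_ge0 n : 0 <= lambda R n.
Proof.
by case: n => [|n]; [have := core01 (lambda0_core R 0)
                    | have := core01 (lambda_core R n)]; lra.
Qed.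

Lemma gamma_spectrum n : lagrange_like_spectrum R (gamma R n.+1).
Proof.
by rewrite spectrumE; exists (lambda R n.+1); first exact: lambda_lower_limit.
Qed.

Lemma gamma_incr m n : (1 <= m)%N -> (m < n)%N -> gamma R m < gamma R n.
Proof.
case: m n => [//|m] [//|n] _; rewrite ltnS.
apply: (@homo_ltn _ (fun k => gamma R k.+1) (fun a b => a < b)) => [y x z|k].
  exact: lt_trans.
by rewrite -[gamma R _]/(spectral_map _) spectral_map_lt ?lambda_ge0// lambda_decr.
Qed.

Lemma gamma_lt n : gamma R n.+1 < gamma R 0.
Proof. by rewrite -[gamma R _]/(spectral_map _) spectral_map_lt ?lambda_ge0// lambda_gt. Qed.

Lemma gamma_cvg : gamma R n @[n --> \oo] --> gamma R 0.
Proof.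
rewrite -(cvg_shiftS (gamma R)); apply/cvgrPdist_le => e e0.
have [||N hN] := @expr_small _ (1 / 2 : R) (e / 2); try lra.
exists N => // n /hN qn /=.
apply: (le_trans (spectral_map_dist (lambda_ge0 0) (lambda_ge0 n.+1))).
by have := core_width (lambda0_core R n) (lambda_core R n); lra.
Qed.

Lemma spectrum_lt_gamma0 x : lagrange_like_spectrum R x -> x < gamma R 0 ->
  exists2 n, (1 <= n)%N & gamma R n = x.
Proof.
rewrite spectrumE => -[l Ll <-]; have /andP[l0 _] := lower_limits_ge0 Ll.
rewrite -[gamma R 0]/(spectral_map _) spectral_map_lt ?lambda_ge0//.
by move=> /lower_limit_lambda/(_ Ll)[n ->]; exists n.+1.
Qed.

Lemma spectrum_below_gamma0 : `[3 / 2, gamma R 0[ `&` lagrange_like_spectrum R =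
  [set gamma R n | n in [set n | (1 <= n)%N]].
Proof.
apply/seteqP; split=> [x [/=]|_ [[//|n] _ <-]].
  by rewrite in_itv /= => /andP[_ h] /spectrum_lt_gamma0/(_ h).
split; last exact: gamma_spectrum.
rewrite /= in_itv /= gamma_lt andbT.
have -> : 3 / 2 = gamma R 1.
  have /= := renorm_lambda R 0; rewrite /renorm /gamma /= /Tmap => h.
  have -> : Fix R [:: 2%N] = 1 / 3 by lra.
  by field.
by case: n => // n; apply: ltW; exact: gamma_incr.
Qed.

Lemma incr_injective (u : nat -> R) :
  (forall m n, (m < n)%N -> u m < u n) -> injective u.
Proof. by move=> h m n E; case: (ltngtP m n) => // /h; rewrite E ltxx. Qed.

Lemma card_spectrum_below_gamma0 :
  (`[3 / 2, gamma R 0[ `&` lagrange_like_spectrum R #= [set: nat])%card.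
Proof.
rewrite spectrum_below_gamma0.
have -> : [set gamma R n | n in [set n | (1 <= n)%N]] =
    [set gamma R n.+1 | n in [set: nat]].
  by apply/seteqP; split=> _ [n n1 <-]; [case: n n1 => // n _; exists n | exists n.+1].
apply: inj_card_eq => m n _ _; apply: (@incr_injective (fun k => gamma R k.+1)).
by move=> p q pq; apply: gamma_incr.
Qed.

Lemma gamma0_limit_point : limit_point (lagrange_like_spectrum R) (gamma R 0).
Proof.
move=> U /gamma_cvg[N _ hN]; exists (gamma R N.+1); split.
- by rewrite lt_eqF// gamma_lt.
- exact: gamma_spectrum.
- exact: (hN N.+1 (leqnSn N)).
Qed.

(** Away from gamma_0 only finitely many of the gamma_n are left. *)
Lemma gamma0_least_limit_point x : limit_point (lagrange_like_spectrum R) x ->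
  gamma R 0 <= x.
Proof.
move=> /limit_point_infinite_setP inf; rewrite leNgt; apply/negP => xg.
pose mid := (x + gamma R 0) / 2.
have /gamma_cvg[N _ hN] : nbhs (gamma R 0) `]mid, +oo[%classic.
  by apply: open_nbhs_nbhs; split; [exact: interval_open | rewrite /= in_itv /= /mid; lra].
have /inf[] : nbhs x `]-oo, mid[%classic.
  by apply: open_nbhs_nbhs; split; [exact: interval_open | rewrite /= in_itv /= /mid; lra].
apply: (@sub_finite_set _ _ [set gamma R n | n in `I_N]); last first.
  exact/finite_image/finite_II.
move=> y [/=]; rewrite in_itv /= => ym Ly.
have [|n _ yE] := spectrum_lt_gamma0 Ly; first by move: ym; rewrite /mid; lra.
exists n => //=; rewrite ltnNge; apply/negP => Nn.
by have := hN n Nn; rewrite /= in_itv /= yE; lra.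
Qed.

End BelowGamma0.

(** * Intervals and gaps in the spectrum *)

Lemma spectrum_itv (R : realType) : `[7 / 4, 2] `<=` lagrange_like_spectrum R.
Proof.
move=> x; rewrite /= in_itv /= => /andP[x7 x2]; rewrite spectrumE.
exists (2 / x - 1); last by apply: spectral_mapK; lra.
apply: lower_limits_itv; apply/andP; split.
  by rewrite subr_ge0 ler_pdivlMr; lra.
by rewrite lerBlDr ler_pdivrMr; lra.
Qed.

(** The image of 1/6 + 1/(80 4^N) tends to 12/7 from the left. *)
Lemma spectrum_gap (R : realType) (delta : R) : 0 < delta ->
  ~ (`[12 / 7 - delta, 2] `<=` lagrange_like_spectrum R).
Proof.
move=> d0 sub.
have [||N /(_ N (leqnn _))] := @expr_small _ (1 / 4 : R) delta; try lra.
rewrite div1r exprVn => hN.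
have x0 : (0 : R) < (4 ^+ N)^-1 by rewrite invr_gt0 exprn_gt0.
pose l : R := 1 / 6 + 1 / 80 / 4 ^+ N.
have l0 : 0 <= l by rewrite /l; lra.
have : lagrange_like_spectrum R (spectral_map l).
  apply: sub; rewrite /= in_itv /= {2}/spectral_map ler_pdivrMr; last by lra.
  apply/andP; split; last by lra.
  have h6 : (0 : R) <= 1 / 6 by lra.
  have := spectral_map_dist h6 l0.
  have -> : spectral_map (1 / 6) = 12 / 7 :> R by rewrite /spectral_map; field.
  have -> : `|1 / 6 - l| = 1 / 80 / 4 ^+ N.
    by rewrite distrC ger0_norm /l; lra.
  by move=> /ler_normlW; lra.
rewrite spectrumE => -[l' Ll' E]; have /andP[l'0 _] := lower_limits_ge0 Ll'.
have El : l' = l.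
  by apply/le_anti; rewrite -(spectral_map_le l0 l'0) -(spectral_map_le l'0 l0) E lexx.
by apply: (@gap_near_sixth R N); rewrite -/l -El.
Qed.

Theorem theorem1p1 (R : realType) :
  closed (lagrange_like_spectrum R)
  /\ [/\ limit_point (lagrange_like_spectrum R) (gamma R 0),
         forall x : R, limit_point (lagrange_like_spectrum R) x ->
           gamma R 0 <= x,
         (`[3 / 2, gamma R 0[ `&` lagrange_like_spectrum R #= [set: nat])%card,
         `[3 / 2, gamma R 0[ `&` lagrange_like_spectrum R =
           [set gamma R n | n in [set n | (1 <= n)%N]]
       & (forall m n : nat, (1 <= m)%N -> (m < n)%N -> gamma R m < gamma R n)
         /\ gamma R n @[n --> \oo] --> gamma R 0]
  /\ (`[7 / 4, 2] `<=` lagrange_like_spectrum R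
      /\ forall delta : R, 0 < delta ->
           ~ (`[12 / 7 - delta, 2] `<=` lagrange_like_spectrum R))
  /\ lebesgue_measure (`[3 / 2, 17 / 10] `&` lagrange_like_spectrum R) = 0%E.
Proof.
split; first exact: spectrum_closed.
split.
  split.
  - exact: gamma0_limit_point.
  - exact: gamma0_least_limit_point.
  - exact: card_spectrum_below_gamma0.
  - exact: spectrum_below_gamma0.
  - by split; [exact: gamma_incr | exact: gamma_cvg].
split; first by split; [exact: spectrum_itv | exact: spectrum_gap].
exact: null_spectrum.
Qed.
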